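(* Let $H:\mathbb{R}^N\to\mathbb{R}$ be a differentiable function, let $G:\mathbb{R}^N\to\mathbb{R}^{N\times N}$ be a (possibly state-dependent) matrix, and let $u(t)=(u_1(t),\ldots,u_N(t))^\top\in\mathbb{R}^N$ be any differentiable solution of $$\frac{\mathrm{d}u}{\mathrm{d}t}=G(u)\,\nabla H(u).$$ If the row vector $\vec{1}=(1,1,\ldots,1)$ is in the left kernel of $G$, i.e. $\vec{1}\,G(v)=\vec{0}$ for every $v\in\mathbb{R}^N$, then the system has the mass conservation law in the sense that $$\frac{\mathrm{d}}{\mathrm{d}t}\Big(\sum_{k=1}^N u_k(t)\Big)=0\quad\text{for all } t.$$
   Context: $H$ is called the energy function and $\nabla H(u)$ is its gradient with respect to the state $u$. *)

(* Defs.v *)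
From HB Require Import structures.
From mathcomp Require Import all_boot all_order all_algebra.
From mathcomp Require Import all_classical all_reals all_analysis.

Set Implicit Arguments.
Unset Strict Implicit.
Unset Printing Implicit Defensive.

Import Order.TTheory GRing.Theory Num.Theory.
Import numFieldNormedType.Exports.

Local Open Scope ring_scope.
Local Open Scope classical_set_scope.

(* States are column vectors; [delta_mx i 0] is the i-th vector of the canonical
   basis of R^N, so the i-th entry is the partial derivative of H with respect
   to the i-th coordinate.  Entries are junk values where these do not exist. *)
Definition gradient (R : realType) (N : nat) (H : 'cV[R]_N -> R) (v : 'cV[R]_N) :
  'cV[R]_N := \col_(i < N) 'D_(delta_mx i 0) H v.

(* Main.v *)
Require Import Defs.
From HB Require Import structures.
From mathcomp Require Import all_boot all_order all_algebra.
From mathcomp Require Import all_classical all_reals all_analysis.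

Set Implicit Arguments.
Unset Strict Implicit.
Unset Printing Implicit Defensive.

Import Order.TTheory GRing.Theory Num.Theory.
Import numFieldNormedType.Exports.

Local Open Scope ring_scope.
Local Open Scope classical_set_scope.

(** Total mass is the linear functional [const_mx 1 *m u], so its time derivative is the row of ones
    applied to [G (u t) *m gradient H (u t)]. By associativity this is [(const_mx 1 *m G (u t)) *m
    gradient H (u t)], which vanishes by [G_ker]. The analytic part is [is_derive_coord]:
    matrix-valued maps are differentiated entrywise. *)

Lemma is_derive_coord (R : realType) (V : normedModType R) (m n : nat)
    (M : V -> 'M[R]_(m, n)) (x v : V) (dM : 'M[R]_(m, n)) (i : 'I_m) (j : 'I_n) :
  is_derive x v M dM -> is_derive x v (fun y => M y i j) (dM i j).
Proof.
move=> [Mx <-]; have Mij := (derivable_mxP _ _ _).1 Mx i j.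
by apply: DeriveDef => //; rewrite derive_mx// mxE.
Qed.

Theorem theorem2 (R : realType) (N : nat)
    (H : 'cV[R]_N -> R) (G : 'cV[R]_N -> 'M[R]_N)
    (J : set R) (u : R -> 'cV[R]_N)
    (H_diff : forall v : 'cV[R]_N, differentiable H v)
    (J_open : open J) (J_itv : is_interval J)
    (u_sol : forall t : R, J t ->
      is_derive t (1 : R) u (G (u t) *m gradient H (u t)))
    (G_ker : forall v : 'cV[R]_N, (const_mx 1 : 'rV[R]_N) *m G v = 0) :
  forall t : R, J t ->
    is_derive t (1 : R) (fun s : R => \sum_(k < N) u s k 0) 0.
Proof.
move=> t Jt.
have du_sum : \sum_(k < N) (G (u t) *m gradient H (u t)) k 0 = 0.
  (* The product is a 1 by 1 matrix; its only entry is the sum of the components of the velocity,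
     each with weight 1. *)
  have /matrixP/(_ 0 0) : (const_mx 1 : 'rV[R]_N) *m
      (G (u t) *m gradient H (u t)) = 0 by rewrite mulmxA G_ker mul0mx.
  by rewrite !mxE => E; rewrite -[RHS]E; apply: eq_bigr => k _; rewrite [in RHS]mxE mul1r.
(* The sum is moved into the space of functions, the form that [is_derive_sum] differentiates. *)
have -> : (fun s => \sum_(k < N) u s k 0) = \sum_(k < N) (fun s => u s k 0).
  by apply/funext => s; rewrite fct_sumE.
(* Unfolding the target 0 back into the sum of velocity components lets the two sums match term by
   term. *)
by rewrite -du_sum; apply: is_derive_sum => k; exact/is_derive_coord/u_sol.
Qed.
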